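(* Let $\mathcal{G}$ be the class of geometric distributions on $\mathbb{N}_+=\{1,2,\ldots\}$, parametrized by $\alpha\in(0,1)$: $$p_\alpha(x)=(1-\alpha)\alpha^{x-1},\qquad x\in\mathbb{N}_+.$$ Given samples $X_1,\ldots,X_n$, let $\hat\alpha_n=1-\frac{n}{\sum_{i=1}^nX_i}$ and define the plug-in estimator $$\check M_n=\sum_{x\in\mathbb{N}_+}(1-\hat\alpha_n)\hat\alpha_n^{\,x-1}\,\mathbf{1}\{x\notin\{X_1,\ldots,X_n\}\}.$$ Then $\check M_n$ PAC-learns the missing mass in relative error with respect to $\mathcal{G}$.
   Context: For a probability distribution $p$ on $\mathbb{N}_+$, $\mathbf{P}_p$ denotes probability when $X_1,X_2,\ldots$ are i.i.d. with distribution $p$. The missing mass is $$M_n=M_n(X_1,\ldots,X_n)=\sum_{x\in\mathbb{N}_+}p(x)\,\mathbf{1}\{x\notin\{X_1,\ldots,X_n\}\}.$$ An estimator is a sequence of functions $\hat M_n:\mathbb{N}_+^n\to[0,1]$. It PAC-learns the missing mass in relative error with respect to a family $\mathcal{P}$ of distributions on $\mathbb{N}_+$ if for every $p\in\mathcal{P}$ and every $\epsilon,\delta>0$ there exists $n_0(p,\epsilon,\delta)$ such that for all $n>n_0(p,\epsilon,\delta)$: $$\mathbf{P}_p\left\{\left|\frac{\hat M_n(X_1,\ldots,X_n)}{M_n(X_1,\ldots,X_n)}-1\right|<\epsilon\right\}>1-\delta.$$ Convention: $0^0=1$. *)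

(* Defs.v *)
From HB Require Import structures.
From mathcomp Require Import all_boot all_order all_algebra finmap.
From mathcomp Require Import all_classical all_reals all_analysis.

Set Implicit Arguments.
Unset Strict Implicit.
Unset Printing Implicit Defensive.

Import Order.TTheory GRing.Theory Num.Theory.
Local Open Scope classical_set_scope.
Local Open Scope ring_scope.

Definition posnat : Type := {x : nat | (0 < x)%N}.

HB.instance Definition _ := Countable.on posnat.
HB.instance Definition _ := isPointed.Build posnat (exist _ 1%N isT).
HB.instance Definition _ := @isMeasurable.Build default_measure_display
  posnat (@discrete_measurable posnat) (@discrete_measurable0 posnat)
  (@discrete_measurableC posnat) (@discrete_measurableU posnat).

(* Mutual independence: the product rule over every finite subfamily. *)
Definition mutually_independent (R : realType) (d d' : measure_display)
    (T : measurableType d) (T' : measurableType d') (P : probability T R)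
    (X : nat -> {RV P >-> T'}) : Prop :=
  forall (J : {fset nat}) (A : nat -> set T'), (forall i, measurable (A i)) ->
    P (\bigcap_(i in [set` J]) X i @^-1` A i) =
    (\prod_(i <- J) P (X i @^-1` A i))%E.

Definition iid (R : realType) (d d' : measure_display)
    (T : measurableType d) (T' : measurableType d') (P : probability T R)
    (X : nat -> {RV P >-> T'}) (p : probability T' R) : Prop :=
  (forall i (A : set T'), measurable A -> distribution P (X i) A = p A) /\
  mutually_independent X.

(* X 0, ..., X n.-1 are the samples written X_1, ..., X_n on paper. *)
Definition sample (T T' : Type) (X : nat -> T -> T') (n : nat) (w : T) :
  n.-tuple T' := [tuple X i w | i < n].

Definition point_mass (R : realType) (p : probability posnat R) (x : posnat) :
  R := fine (p [set x]).

(* The mass that q gives to the points not in s; q is a mass function rather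
   than a probability measure so that it also covers the plug-in estimator,
   whose estimated ratio need not lie in the open interval ]0, 1[. *)
Definition unseen_mass (R : realType) (q : posnat -> R) (n : nat)
    (s : n.-tuple posnat) : R :=
  fine (\esum_(x in [set: posnat]) (q x * (x \notin s)%:R)%:E).

Definition missing_mass (R : realType) (p : probability posnat R) (n : nat)
    (s : n.-tuple posnat) : R :=
  unseen_mass (point_mass p) s.

Definition is_estimator (R : realType)
    (Mhat : forall n : nat, n.-tuple posnat -> R) : Prop :=
  forall n (s : n.-tuple posnat), 0 <= Mhat n s <= 1.

(* P_p is probability on an arbitrary space carrying an i.i.d. sequence with
   law p; n0 depends on p, eps and delta only, not on that space.  Division by
   zero yields 0, so where the missing mass vanishes the relative error is 1:
   such outcomes are failures for every eps <= 1. *)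
Definition PAC_learns_relative (R : realType)
    (Mhat : forall n : nat, n.-tuple posnat -> R)
    (F : set (probability posnat R)) : Prop :=
  forall p, F p -> forall eps delta : R, 0 < eps -> 0 < delta ->
  exists n0 : nat,
  forall (d : measure_display) (T : measurableType d) (P : probability T R)
    (X : nat -> {RV P >-> posnat}), iid X p ->
  forall n : nat, (n0 < n)%N ->
    ((1 - delta)%:E <
     P [set w | (`|Mhat n (sample X n w) / missing_mass p (sample X n w) - 1|
                 < eps)%R])%E.

Definition geometric_pmf (R : realType) (a : R) (x : posnat) : R :=
  (1 - a) * a ^+ (\val x).-1.

Definition geometric_family (R : realType) : set (probability posnat R) :=
  [set p | exists a : R, 0 < a < 1 /\ point_mass p = geometric_pmf a].

Definition alpha_hat (R : realType) (n : nat) (s : n.-tuple posnat) : R :=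
  1 - n%:R / \sum_(i < n) (\val (tnth s i))%:R.

Definition plug_in (R : realType) (n : nat) (s : n.-tuple posnat) : R :=
  unseen_mass (geometric_pmf (alpha_hat R s)) s.

(* Main.v *)
Require Import Defs.
From HB Require Import structures.
From mathcomp Require Import all_boot all_order all_algebra finmap ring lra.
From mathcomp Require Import all_classical all_reals all_analysis.

Set Implicit Arguments.
Unset Strict Implicit.
Unset Printing Implicit Defensive.

Import Order.TTheory GRing.Theory Num.Theory.
Import numFieldNormedType.Exports.
Local Open Scope classical_set_scope.
Local Open Scope ring_scope.

(* If every sample is at most t, then all x > t are unseen, and a geometric law
   of ratio b leaves unseen the mass b^t + (the sum of (1 - b) b^(x-1) over the
   unseen x <= t).  The plug-in estimate and the missing mass thus compare term
   by term, each ratio being a product of at most t + 1 factors b/a or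
   (1 - b)/(1 - a); all are close to 1 once the estimated ratio b is within
   O(1/t) of the true ratio a.
   Take t close to the cube root of n.  A sample exceeds t with probability at
   most n a^t, and |b - a| is at most the deviation of the empirical mean from
   1/(1 - a), which Chebyshev's inequality controls.  Restricting to samples at
   most t makes Chebyshev's inequality a computation with finite sums over
   {ffun 'I_n -> 'I_t}; the price is that the truncated law has the small bias
   - t a^t.  The failure probability is O(1/t). *)

(** * Second moments under a product of subprobability weights *)

Lemma sum_ffun_sq_le (R : realFieldType) (n t : nat) (p f : 'I_t -> R) :
    (forall x, 0 <= p x) -> \sum_x p x <= 1 ->
  \sum_(s : {ffun 'I_n -> 'I_t}) (\prod_i p (s i)) * (\sum_i f (s i)) ^+ 2 <=
  n%:R * (\sum_x p x * f x ^+ 2) + n%:R ^+ 2 * (\sum_x p x * f x) ^+ 2.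
Proof.
move=> p0 p1; set A := \sum_x p x * f x; set B := \sum_x p x * f x ^+ 2.
have B0 : 0 <= B by apply: sumr_ge0 => x _; rewrite mulr_ge0 ?sqr_ge0.
have m0 : 0 <= \sum_x p x by apply: sumr_ge0.
(* Expanding the square leaves, for fixed i and j, a sum over s of a product over coordinates;
   [g i j k x] is the factor of coordinate k, so sum and product can be exchanged. *)
pose g (i j k : 'I_n) x := p x * ((if k == i then f x else 1) * (if k == j then f x else 1)).
have -> : \sum_(s : {ffun 'I_n -> 'I_t}) (\prod_i p (s i)) * (\sum_i f (s i)) ^+ 2 =
    \sum_i \sum_j \prod_k \sum_x g i j k x.
  under [RHS]eq_bigr do under eq_bigr do rewrite bigA_distr_bigA.
  under [RHS]eq_bigr do rewrite exchange_big /=.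
  rewrite [RHS]exchange_big /=; apply: eq_bigr => s _.
  rewrite expr2 mulr_suml mulr_sumr; apply: eq_bigr => i _.
  rewrite 2!mulr_sumr; apply: eq_bigr => j _.
  by rewrite /g !big_split /= -!big_mkcond /= !big_pred1_eq.
have prod_le1 (P : pred 'I_n) : 0 <= \prod_(k | P k) \sum_x p x <= 1.
  by rewrite prodr_ge0 //= prodr_ile1 // => i _; rewrite m0 p1.
(* Coordinates other than i and j contribute the total mass, at most 1. Adding [A ^+ 2] on the
   diagonal as well makes the bound uniform, which gives the count [n ^ 2]. *)
have le_ij (i j : 'I_n) : \prod_k \sum_x g i j k x <= (if j == i then B else 0) + A ^+ 2.
  case: eqVneq => [->|ji].
    rewrite (bigD1 i) //= [X in _ * X](eq_bigr (fun=> \sum_x p x)); last first.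
      by move=> k /negbTE ki; apply: eq_bigr => x _; rewrite /g ki !mulr1.
    have -> : \sum_x g i i i x = B.
      by apply: eq_bigr => x _; rewrite /g eqxx expr2.
    have /andP[_ le1] := prod_le1 (fun k => k != i).
    by rewrite ler_wpDr ?sqr_ge0 // ler_piMr.
  rewrite add0r (bigD1 i) //= (bigD1 j) //=
    [X in _ * (_ * X)](eq_bigr (fun=> \sum_x p x)); last first.
    move=> k /andP[/negbTE ki /negbTE kj].
    by apply: eq_bigr => x _; rewrite /g ki kj !mulr1.
  have -> : \sum_x g i j i x = A.
    by apply: eq_bigr => x _; rewrite /g eqxx eq_sym (negbTE ji) mulr1.
  have -> : \sum_x g i j j x = A.
    by apply: eq_bigr => x _; rewrite /g eqxx (negbTE ji) mul1r.
  have /andP[_ le1] := prod_le1 (fun k => (k != i) && (k != j)).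
  by rewrite mulrA -expr2 ler_piMr ?sqr_ge0.
apply: (@le_trans _ _ (\sum_(i < n) \sum_(j < n) ((if j == i then B else 0) + A ^+ 2))).
  by apply: ler_sum => i _; apply: ler_sum => j _.
under eq_bigr do rewrite big_split /= -big_mkcond /= big_pred1_eq sumr_const card_ord.
by rewrite sumr_const card_ord -[_ *+ n]mulr_natl -[_ ^+ 2 *+ n]mulr_natl mulrDr mulrA expr2.
Qed.

(** Markov's inequality for the squared sum. The second moment replaces the variance because a
    truncated law is not centred; its bias is the term in [n ^ 2]. *)
Lemma ffun_chebyshev (R : realFieldType) (n t : nat) (p f : 'I_t -> R) (c : R) :
    (forall x, 0 <= p x) -> \sum_x p x <= 1 -> 0 < c ->
  \sum_(s : {ffun 'I_n -> 'I_t} | c < `|\sum_i f (s i)|) \prod_i p (s i) <=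
  (n%:R * (\sum_x p x * f x ^+ 2) + n%:R ^+ 2 * (\sum_x p x * f x) ^+ 2) / c ^+ 2.
Proof.
move=> p0 p1 c0; rewrite ler_pdivlMr ?exprn_gt0 //.
apply: le_trans (sum_ffun_sq_le n f p0 p1).
have w0 (s : {ffun 'I_n -> 'I_t}) : 0 <= \prod_i p (s i) by apply: prodr_ge0.
rewrite mulr_suml big_mkcond; apply: ler_sum => s _.
case: ifP => [cs|_]; last by rewrite mulr_ge0 ?sqr_ge0.
apply: ler_wpM2l => //.
by rewrite -[leRHS]real_normK ?num_real // lerXn2r // ?nnegrE ?ltW.
Qed.

(** * Moments of the truncated geometric law *)

Lemma geom_sum (R : fieldType) (a : R) (t : nat) :
  \sum_(x < t) (1 - a) * a ^+ x = 1 - a ^+ t.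
Proof.
elim: t => [|t IH]; first by rewrite big_ord0 expr0 subrr.
by rewrite big_ord_recr /= IH exprS; ring.
Qed.

(** For 0 < a < 1 the full law has mean 1/(1 - a), so the full series vanishes and the truncation
    bias is minus the tail. *)
Lemma geom_sum_centered (R : fieldType) (a : R) (t : nat) : 1 - a != 0 ->
  \sum_(x < t) (1 - a) * a ^+ x * (x.+1%:R - (1 - a)^-1) = - (t%:R * a ^+ t).
Proof.
move=> a1; elim: t => [|t IH]; first by rewrite big_ord0 mul0r oppr0.
by rewrite big_ord_recr /= IH (exprS a t) -natr1; field.
Qed.

(** For 0 < a < 1 this is the variance of the full law minus the tail; by memorylessness the tail is
    [a ^+ t] times the second moment of the centred variable shifted by t. *)
Lemma geom_sum_centered_sq (R : fieldType) (a : R) (t : nat) : 1 - a != 0 ->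
  \sum_(x < t) (1 - a) * a ^+ x * (x.+1%:R - (1 - a)^-1) ^+ 2 =
  a / (1 - a) ^+ 2 - a ^+ t * (a / (1 - a) ^+ 2 + t%:R ^+ 2).
Proof.
move=> a1; elim: t => [|t IH]; first by rewrite big_ord0 expr0; ring.
by rewrite big_ord_recr /= IH (exprS a t) -natr1; field.
Qed.

(** * Products of factors close to 1 *)

Lemma expr_bernoulli (R : realFieldType) (h : R) (k : nat) :
  -1 <= h -> 1 + k%:R * h <= (1 + h) ^+ k.
Proof.
move=> h1; elim: k => [|k IH]; first by rewrite mul0r addr0.
have h0 : 0 <= 1 + h by lra.
rewrite exprS; apply: le_trans (ler_wpM2l h0 IH).
rewrite -natr1 -subr_ge0; have k0 : 0 <= k%:R :> R by [].
have := mulr_ge0 k0 (sqr_ge0 h); rewrite expr2; lra.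
Qed.

(** Bernoulli gives (1 - h)^k >= 1 - th. Since (1 + h)^k (1 - h)^k <= 1, also (1 + h)^k <= 1/(1 -
    th), which is at most 1 + 2 th because th <= 1/2. *)
Lemma exprDn_near1 (R : realFieldType) (t k : nat) (h th y : R) :
   (k <= t)%N -> 0 <= h -> t%:R * h <= th -> th <= 2^-1 -> 
   (1 - h) ^+ k <= y <= (1 + h) ^+ k -> `|y - 1| <= 2 * th.
Proof.
move=> kt h0 hth th2 /andP[yl yu].
have kh : k%:R * h <= th.
  by apply: le_trans hth; rewrite ler_wpM2r // ler_nat.
(* Bernoulli is applied to -h and so requires h <= 1; this follows from k h <= 1/2 only for positive
   k. *)
case: k kt kh yl yu => [|k] kt kh yl yu.
  rewrite !expr0 in yl yu; rewrite ler_norml; lra.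
have h1 : h <= 1.
  have : 1 * h <= k.+1%:R * h by rewrite ler_wpM2r // ler1n.
  lra.
have Bm := @expr_bernoulli _ (- h) k.+1 ltac:(lra).
have u1 : (1 + h) ^+ k.+1 * (1 - h) ^+ k.+1 <= 1.
  rewrite -exprMn exprn_ile1 //; nra.
have u0 : 0 <= (1 + h) ^+ k.+1 by rewrite exprn_ge0 //; lra.
have th0 : 0 <= th by apply: le_trans kh; rewrite mulr_ge0.
rewrite ler_norml; apply/andP; split; first lra.
have : (1 + h) ^+ k.+1 * (1 - th) <= 1 by apply: le_trans u1; rewrite ler_wpM2l //; lra.
nra.
Qed.

(** * Unseen mass of geometric laws *)

Definition posnat_of (k : nat) : posnat := exist _ k.+1 isT.

Lemma posnat_of_bij : set_bij [set: nat] [set: posnat] posnat_of.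
Proof.
split=> // [k l _ _ [->//]|[k k0] _]; exists k.-1 => //.
by apply: val_inj => /=; rewrite prednK.
Qed.

(** Beyond t every point is unseen, so the partial sums from t on telescope to the limit minus
    [b ^+ (N + t)]. The ratio 0 is allowed because [alpha_hat] vanishes when a nonempty sample
    consists of ones. *)
Lemma unseen_mass_geometric (R : realType) (b : R) (n t : nat)
    (s : n.-tuple posnat) :
    0 <= b < 1 -> (forall x, x \in s -> (val x <= t)%N) ->
  unseen_mass (geometric_pmf b) s =
  \sum_(k < t) (1 - b) * b ^+ k * (posnat_of k \notin s)%:R + b ^+ t.
Proof.
move=> /andP[b0 b1] s_le; set L : R := RHS.
pose v k := (1 - b) * b ^+ k * (posnat_of k \notin s)%:R.
have v0 k : 0 <= v k by rewrite !mulr_ge0 ?exprn_ge0 // subr_ge0 ltW.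
have seriesE N : series v (N + t)%N = L - b ^+ (N + t).
  elim: N => [|N IH].
    by rewrite add0n /series /= big_mkord /L addrK.
  have unseen : posnat_of (N + t) \notin s.
    by apply/negP => /s_le /=; rewrite ltnNge leq_addl.
  by rewrite addSn seriesSr IH /v unseen mulr1 exprS; ring.
have cvgL : series v @ \oo --> L.
  have cvgb : (fun N => b ^+ (N + t)) @ \oo --> (0 : R).
    by rewrite (cvg_shiftn t (fun N => b ^+ N)); apply: cvg_expr; rewrite ger0_norm.
  have cvgLb : (fun N => L - b ^+ (N + t)) @ \oo --> L - 0.
    by apply: cvgB cvgb; exact: cvg_cst.
  rewrite subr0 in cvgLb; rewrite -(cvg_shiftn t).
  by apply: cvg_trans cvgLb; apply: near_eq_cvg; apply: nearW => N; exact/esym/seriesE.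
rewrite /unseen_mass (reindex_esum _ _ _ _ posnat_of_bij) -nneseries_esumT; last first.
  by move=> k; rewrite lee_fin; exact: v0.
rewrite (_ : (fun N => _) = EFin \o series v); last first.
  by apply/funext => N; rewrite /= sumEFin.
by rewrite EFin_lim ?(cvg_lim _ cvgL) //; apply/cvg_ex; exists L.
Qed.

(** The weights c stand for the indicators of unseen points. They are nonnegative and common to both
    sums, so a relative error of [2 * th] in each term passes to the sums. *)
Lemma geometric_ratio_near1 (R : realFieldType) (a b h th : R) (t : nat)
    (c : 'I_t -> R) :
    0 < a < 1 -> (forall k, 0 <= c k) -> `|b - a| <= h * (a * (1 - a)) ->
    t.+1%:R * h <= th -> th <= 2^-1 ->
  `|(\sum_(k < t) (1 - b) * b ^+ k * c k + b ^+ t) /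
    (\sum_(k < t) (1 - a) * a ^+ k * c k + a ^+ t) - 1| <= 2 * th.
Proof.
move=> /andP[a0 a1] c0 ba hth th2.
have aa0 : 0 < a * (1 - a) by rewrite mulr_gt0 // subr_gt0.
have h0 : 0 <= h by rewrite -(pmulr_lge0 _ aa0) (le_trans _ ba).
have h2 : h <= 2^-1.
  apply: le_trans th2; apply: le_trans hth.
  by rewrite ler_peMl // ler1n.
have aA : 0 < 1 - a by rewrite subr_gt0.
(* The scale a (1 - a) is at most a and at most 1 - a, so h bounds the relative errors of both b and
   1 - b. *)
have /andP[bl bu] : a * (1 - h) <= b <= a * (1 + h).
  move: ba; rewrite ler_norml => /andP[? ?].
  have : 0 <= h * a * a by rewrite !mulr_ge0 // ltW.
  by move=> ?; apply/andP; split; lra.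
have /andP[bl' bu'] : (1 - a) * (1 - h) <= 1 - b <= (1 - a) * (1 + h).
  move: ba; rewrite ler_norml => /andP[? ?].
  have : 0 <= h * (1 - a) * (1 - a) by rewrite !mulr_ge0 // ltW.
  by move=> ?; apply/andP; split; lra.
have h1 : 0 <= 1 - h by lra.
have h1' : 0 <= 1 + h by lra.
have r_bnd k : (1 - h) ^+ k <= (b / a) ^+ k <= (1 + h) ^+ k.
  have /andP[rl ru] : 1 - h <= b / a <= 1 + h.
    by rewrite ler_pdivlMr // ler_pdivrMr // ![_ * a]mulrC bl.
  by rewrite !lerXn2r // ?nnegrE // (le_trans h1).
have ba0 : 0 <= b / a by rewrite divr_ge0 ?(ltW a0) // (le_trans _ bl) // mulr_ge0 ?(ltW a0).
have q_bnd : 1 - h <= (1 - b) / (1 - a) <= 1 + h.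
  by rewrite ler_pdivlMr // ler_pdivrMr // ![_ * (1 - a)]mulrC bl'.
have near_t : `|b ^+ t - a ^+ t| <= 2 * th * a ^+ t.
  have -> : b ^+ t - a ^+ t = ((b / a) ^+ t - 1) * a ^+ t.
    by rewrite mulrBl mul1r -exprMn divfK ?gt_eqF.
  rewrite normrM [X in _ * X]gtr0_norm ?exprn_gt0 // ler_pM2r ?exprn_gt0 //.
  exact: exprDn_near1 (leqnSn t) h0 hth th2 (r_bnd t).
have near_k (k : 'I_t) : `|(1 - b) * b ^+ k - (1 - a) * a ^+ k| <=
    2 * th * ((1 - a) * a ^+ k).
  have -> : (1 - b) * b ^+ k - (1 - a) * a ^+ k =
      ((1 - b) / (1 - a) * (b / a) ^+ k - 1) * ((1 - a) * a ^+ k).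
    rewrite [RHS]mulrBl [in RHS]mul1r mulrACA divfK ?gt_eqF //.
    by rewrite -exprMn divfK ?gt_eqF.
  have w0 : 0 < (1 - a) * a ^+ k by rewrite mulr_gt0 ?exprn_gt0.
  rewrite normrM [X in _ * X]gtr0_norm // ler_pM2r //.
  apply: (@exprDn_near1 _ t.+1 k.+1 h) => //; first by rewrite ltnS ltnW.
  case/andP: q_bnd => ql qu; case/andP: (r_bnd k) => rl ru.
  by rewrite !exprS !ler_pM ?exprn_ge0 // (le_trans h1 ql).
set ub := _ + b ^+ t; set ua := _ + a ^+ t.
have ua0 : 0 < ua.
  rewrite ltr_wpDl ?exprn_gt0 // sumr_ge0 // => k _.
  by rewrite !mulr_ge0 ?exprn_ge0 ?c0 // ltW.
have -> : ub / ua - 1 = (ub - ua) / ua by rewrite mulrBl divff ?gt_eqF.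
rewrite normrM normfV [X in _ / X]gtr0_norm // ler_pdivrMr //.
have -> : ub - ua = \sum_(k < t) ((1 - b) * b ^+ k - (1 - a) * a ^+ k) * c k +
    (b ^+ t - a ^+ t).
  rewrite /ub /ua; under [X in _ = X + _]eq_bigr do rewrite mulrBl.
  rewrite sumrB; ring.
apply: le_trans (ler_normD _ _) _; rewrite mulrDr lerD //.
apply: le_trans (ler_norm_sum _ _ _) _; rewrite mulr_sumr ler_sum // => k _.
by rewrite normrM (ger0_norm (c0 k)) mulrA ler_wpM2r.
Qed.

(** * The law of an i.i.d. sample *)

Definition posnat_tuple n t (s : {ffun 'I_n -> 'I_t}) : n.-tuple posnat :=
  [tuple posnat_of (s i) | i < n].

Lemma posnat_tuple_inj n t : injective (@posnat_tuple n t).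
Proof.
move=> s s' /(congr1 (fun r => tnth r)) e; apply/ffunP => i.
have := congr1 (fun g => val (g i)) e; rewrite /= !tnth_mktuple => -[].
exact: ord_inj.
Qed.

Section iid_sample.
Context (R : realType) (d : measure_display) (T : measurableType d).
Context (P : probability T R) (X : nat -> {RV P >-> posnat}).

(** Independence is stated over finite sets of natural numbers, hence [nth] with a default [x0] that
    no index below n reaches. *)
Lemma sample_eqE n (r : n.-tuple posnat) (x0 : posnat) :
  [set w | sample X n w = r] =
  \bigcap_(i in [set` [fset i in iota 0 n]%fset]) X i @^-1` [set nth x0 r i].
Proof.
apply/seteqP; split=> [w <- i i_n|w /= wr].
  have lt_in : (i < n)%N by move: i_n; rewrite /= !inE mem_iota.
  have := tnth_mktuple (fun i : 'I_n => X i w) (Ordinal lt_in).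
  by rewrite (tnth_nth x0) => /esym.
apply: eq_from_tnth => i; rewrite tnth_mktuple (tnth_nth x0).
by apply: wr; rewrite /= !inE mem_iota add0n /=.
Qed.

Lemma measurable_sample_eq n (r : n.-tuple posnat) :
  measurable [set w | sample X n w = r].
Proof.
rewrite (sample_eqE r point); apply: bigcap_measurableType => i _.
by rewrite -[X in measurable X]setTI; exact: measurable_funP.
Qed.

(** There are countably many tuples, so the event is a countable union of events fixing the whole
    sample. *)
Lemma measurable_sample n (C : set (n.-tuple posnat)) :
  measurable [set w | C (sample X n w)].
Proof.
rewrite (_ : [set _ | _] = \bigcup_r ([set w | C r] `&` [set w | sample X n w = r])).
  apply: countable_bigcupT_measurable => // r; apply: measurableI.
    have [Cr|Cr] := pselect (C r).
      by rewrite (_ : [set _ | _] = setT) //; apply/seteqP; split.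
    by rewrite (_ : [set _ | _] = set0) //; apply/seteqP; split.
  exact: measurable_sample_eq.
by apply/seteqP; split=> [w /= Cw|w [r _ [/= Cr ->]]] //; exists (sample X n w).
Qed.

Lemma prob_sample_eq (p : probability posnat R) n (r : n.-tuple posnat) :
  iid X p ->
  P [set w | sample X n w = r] = (\prod_(i < n) point_mass p (tnth r i))%:E.
Proof.
move=> [Xp Xind]; rewrite (sample_eqE r point) Xind // -prodEFin.
rewrite (perm_big (iota 0 n)) /=; last first.
  by apply: uniq_perm; rewrite ?iota_uniq ?fset_uniq // => i; rewrite !inE.
rewrite -{1}[n]subn0 -/(index_iota 0 n) big_mkord; apply: eq_bigr => i _.
have mri : measurable [set nth point r i] by [].
have := Xp i _ mri; rewrite /distribution /pushforward /= => ->.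
by rewrite /point_mass fineK ?fin_num_measure // -tnth_nth.
Qed.

(** Distinct tuples give disjoint events, so finitely many good tuples bound the probability below
    by a finite sum of products. *)
Lemma prob_sample_ge (p : probability posnat R) n t (C : set (n.-tuple posnat))
    (good : pred {ffun 'I_n -> 'I_t}) :
    iid X p -> (forall s, good s -> C (posnat_tuple s)) ->
  ((\sum_(s | good s) \prod_i point_mass p (posnat_of (s i)))%:E <=
   P [set w | C (sample X n w)])%E.
Proof.
move=> Xp goodC; pose F s := [set w | sample X n w = @posnat_tuple n t s].
have -> : (\sum_(s | good s) \prod_i point_mass p (posnat_of (s i)))%:E =
    P (\bigcup_(s in [set` enum good]) F s).
  rewrite measure_fin_bigcup //; last by move=> s _; exact: measurable_sample_eq.
    rewrite -fsbig_seq ?enum_uniq // big_enum -sumEFin /=.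
    apply: eq_bigr => s _; rewrite (prob_sample_eq _ Xp).
    by congr EFin; apply: eq_bigr => i _; rewrite tnth_mktuple.
  by move=> s s' _ _ [w [sw s'w]]; apply: posnat_tuple_inj; exact: etrans (esym sw) s'w.
apply: le_measure; rewrite ?inE.
- by apply: fin_bigcup_measurable => // s _; exact: measurable_sample_eq.
- exact: measurable_sample.
- by move=> w [s]; rewrite /= mem_enum => /goodC Cs ->.
Qed.

End iid_sample.

(** * The estimated ratio and the plug-in estimate *)

Lemma sum_sample_ge (R : realType) n (s : n.-tuple posnat) :
  n%:R <= \sum_(i < n) (\val (tnth s i))%:R :> R.
Proof.
have -> : n%:R = \sum_(i < n) 1 :> R by rewrite sumr_const card_ord.
by apply: ler_sum => i _; rewrite ler1n; exact: valP (tnth s i).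
Qed.

Lemma alpha_hat_bounds (R : realType) n (s : n.-tuple posnat) :
  (0 < n)%N -> 0 <= alpha_hat R s < 1.
Proof.
move=> n0; have sn := sum_sample_ge R s; rewrite /alpha_hat; set S := (\sum_(_ < _) _) in sn *.
have n0R : 0 < n%:R :> R by rewrite ltr0n.
have S0 : 0 < S by apply: lt_le_trans sn.
by rewrite subr_ge0 ltrBlDr ltrDl divr_gt0 // andbT ler_pdivrMr // mul1r.
Qed.

(** With S the sum of the samples, the error is (1 - a)/S times S - n/(1 - a), and S >= n while 1 -
    a <= 1. *)
Lemma alpha_hat_close (R : realType) n (s : n.-tuple posnat) (a u : R) :
    (0 < n)%N -> 0 < a < 1 ->
    `|\sum_(i < n) ((\val (tnth s i))%:R - (1 - a)^-1)| <= n%:R * u ->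
  `|alpha_hat R s - a| <= u.
Proof.
move=> n0 /andP[a0 a1]; have sn := sum_sample_ge R s; rewrite sumrB sumr_const card_ord.
rewrite /alpha_hat; set S := (\sum_(_ < _) _) in sn * => S_near.
have n0R : 0 < n%:R :> R by rewrite ltr0n.
have S0 : 0 < S by apply: lt_le_trans sn.
have -> : 1 - n%:R / S - a = (1 - a) / S * (S - (1 - a)^-1 *+ n).
  by rewrite -mulr_natr; field; rewrite subr_eq0 !gt_eqF.
have u0 : 0 <= u by rewrite -(pmulr_rge0 _ n0R) (le_trans _ S_near).
rewrite normrM ger0_norm ?divr_ge0 ?subr_ge0 ?(ltW a1) ?(ltW S0) //.
rewrite mulrAC ler_pdivrMr //; apply: (@le_trans _ _ (n%:R * u)).
  apply: le_trans S_near; rewrite ler_piMl //; lra.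
by rewrite mulrC ler_wpM2l.
Qed.

Lemma plug_in_estimator (R : realType) : is_estimator (@plug_in R).
Proof.
move=> [|n] s.
  (* Without samples 0/0 = 0 makes [alpha_hat] equal to 1, so the estimated mass function is
     zero. *)
  rewrite /plug_in /unseen_mass esum1 ?lexx ?ler01 // => x _.
  by rewrite /geometric_pmf /alpha_hat mul0r subr0 subrr !mul0r.
have [t s_le] : exists t, forall x, x \in s -> (val x <= t)%N.
  exists (\max_(i < n.+1) val (tnth s i)) => x /tnthP[i ->].
  exact: (leq_bigmax_cond (F := fun i => val (tnth s i))).
have ah := @alpha_hat_bounds R n.+1 s isT.
rewrite /plug_in (unseen_mass_geometric ah s_le).
case/andP: ah; move: (alpha_hat R s) => b b0 b1.
have w0 k : 0 <= (1 - b) * b ^+ k by rewrite mulr_ge0 ?exprn_ge0 // subr_ge0 ltW.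
apply/andP; split.
  by rewrite addr_ge0 ?exprn_ge0 // sumr_ge0 // => k _; rewrite mulr_ge0.
rewrite -lerBrDr -geom_sum ler_sum // => k _.
by rewrite ler_piMr // lern1 leq_b1.
Qed.

Lemma plug_in_ratio_near1 (R : realType) (p : probability posnat R) (a h th : R) n t
    (s : n.-tuple posnat) :
    (0 < n)%N -> 0 < a < 1 -> point_mass p = geometric_pmf a ->
    (forall x, x \in s -> (val x <= t)%N) ->
    `|\sum_(i < n) ((\val (tnth s i))%:R - (1 - a)^-1)| <= n%:R * (h * (a * (1 - a))) ->
    t.+1%:R * h <= th -> th <= 2^-1 ->
  `|plug_in R s / missing_mass p s - 1| <= 2 * th.
Proof.
move=> n0 a01 pa s_le s_near hth th2.
rewrite /plug_in /missing_mass pa !(unseen_mass_geometric _ s_le)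
  ?alpha_hat_bounds //; last first.
  by case/andP: a01 => /ltW -> ->.
by apply: (geometric_ratio_near1 a01 _ _ hth th2) => //; exact: alpha_hat_close.
Qed.

(** The two subtracted terms bound the probability that some sample exceeds t and the Chebyshev
    probability of a large deviation among samples at most t. *)
Lemma plug_in_success (R : realType) (p : probability posnat R) (a h th : R) n t
    (d : measure_display) (T : measurableType d) (P : probability T R)
    (X : nat -> {RV P >-> posnat}) :
    iid X p -> (0 < n)%N -> 0 < a < 1 -> point_mass p = geometric_pmf a ->
    0 < h -> t.+1%:R * h <= th -> th <= 2^-1 ->
  ((1 - n%:R * a ^+ t -
    (n%:R * (a / (1 - a) ^+ 2) + n%:R ^+ 2 * (t%:R * a ^+ t) ^+ 2) /
      (n%:R * (h * (a * (1 - a)))) ^+ 2)%:E <=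
   P [set w | (`|plug_in R (sample X n w) / missing_mass p (sample X n w) - 1| <= 2 * th)%R])%E.
Proof.
move=> Xp n0 a01 pa h0 hth th2; case/andP: (a01) => a0 a1.
set c := n%:R * (h * _).
have c0 : 0 < c by rewrite !mulr_gt0 ?ltr0n // subr_gt0.
pose f (k : 'I_t) : R := k.+1%:R - (1 - a)^-1.
pose q (k : 'I_t) := (1 - a) * a ^+ k.
have q0 k : 0 <= q k by rewrite mulr_ge0 ?exprn_ge0 ?(ltW a0) // subr_ge0 ltW.
have q_sum : \sum_k q k = 1 - a ^+ t by exact: geom_sum.
have q1 : \sum_k q k <= 1 by rewrite q_sum gerBl exprn_ge0 // ltW.
pose good (s : {ffun 'I_n -> 'I_t}) := ~~ (c < `|\sum_i f (s i)|).
apply: le_trans (prob_sample_ge (C := fun s => `|plug_in R s / missing_mass p s - 1| <= 2 * th)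
  (good := good) Xp _); last first.
  move=> s; rewrite /good -leNgt => s_near.
  apply: (plug_in_ratio_near1 n0 a01 pa _ _ hth th2).
    by move=> x /tnthP[i ->]; rewrite tnth_mktuple /=.
  by under eq_bigr do rewrite tnth_mktuple /=.
rewrite lee_fin.
have -> : \sum_(s | good s) \prod_i point_mass p (posnat_of (s i)) =
    \sum_(s : {ffun 'I_n -> 'I_t}) \prod_i q (s i) -
    \sum_(s : {ffun 'I_n -> 'I_t} | c < `|\sum_i f (s i)|) \prod_i q (s i).
  rewrite [X in X - _](bigID (fun s : {ffun 'I_n -> 'I_t} => c < `|\sum_i f (s i)|)) /=.
  by rewrite addrAC subrr add0r pa.
apply: lerB.
  (* All samples are at most t with probability (1 - a^t)^n, at least 1 - n a^t by Bernoulli. *)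
  rewrite -(bigA_distr_bigA (fun _ k => q k)) /= prodr_const card_ord q_sum.
  have := @expr_bernoulli _ (- a ^+ t) n; rewrite mulrN; apply.
  by rewrite lerN2 exprn_ile1 // ltW.
apply: le_trans (ffun_chebyshev n f q0 q1 c0) _.
rewrite ler_pM2r ?invr_gt0 ?exprn_gt0 // lerD //; last first.
  rewrite geom_sum_centered ?sqrrN // subr_eq0 gt_eqF //.
rewrite ler_wpM2l // geom_sum_centered_sq ?subr_eq0 ?gt_eqF // gerBl.
rewrite mulr_ge0 ?exprn_ge0 ?(ltW a0) // addr_ge0 ?sqr_ge0 //.
by rewrite divr_ge0 ?sqr_ge0 // ltW.
Qed.

(** * Choice of the truncation level *)

Lemma succX4_geom_bounded (R : rcfType) (a : R) : 0 < a < 1 ->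
  exists2 K : R, 0 < K & forall t : nat, t.+1%:R ^+ 4 * a ^+ t <= K.
Proof.
move=> /andP[a0 a1]; pose b := Num.sqrt (Num.sqrt a).
have b0 : 0 < b by rewrite !sqrtr_gt0.
have b4 : b ^+ 4 = a by rewrite -[4%N]/(2 * 2)%N exprM !sqr_sqrtr ?sqrtr_ge0 // ltW.
have b1 : b < 1 by rewrite -(@ltr_pXn2r _ 4) ?nnegrE ?(ltW b0) // b4 expr1n.
have y0 : 0 < b^-1 - 1 by rewrite subr_gt0 invf_gt1.
(* With b the fourth root of a, Bernoulli gives b^(-t) >= 1 + t (1/b - 1) >= m (t + 1); the fourth
   power of (t + 1) b^t <= 1/m is the claim. *)
pose m := Num.min 1 (b^-1 - 1).
have m0 : 0 < m by rewrite lt_min ltr01.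
have [m1 my] : m <= 1 /\ m <= b^-1 - 1 by rewrite !ge_min !lexx orbT.
exists (m^-1 ^+ 4) => [|t]; first by rewrite exprn_gt0 // invr_gt0.
rewrite -b4 -exprM mulnC exprM -exprMn
  lerXn2r ?nnegrE ?mulr_ge0 ?exprn_ge0 ?invr_ge0 ?(ltW b0) ?(ltW m0) //.
have bt0 : 0 < b ^+ t by rewrite exprn_gt0.
rewrite -[leRHS]mul1r ler_pdivlMr // mulrAC -ler_pdivlMr // div1r -exprVn.
have -> : b^-1 = 1 + (b^-1 - 1) by rewrite addrC subrK.
apply: le_trans (expr_bernoulli t _); last by lra.
have : 0 <= t%:R * (b^-1 - 1 - m) by rewrite mulr_ge0 // subr_ge0.
rewrite -natr1; lra.
Qed.

Lemma cube_root_floor (n : nat) : exists t, (t ^ 3 <= n < t.+1 ^ 3)%N.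
Proof.
elim: n => [|n [t /andP[tn nt]]]; first by exists 0%N.
have [lt|ge] := ltnP n.+1 (t.+1 ^ 3); first by exists t; rewrite lt (leq_trans tn).
by exists t.+1; rewrite ge /= (leq_ltn_trans nt) // ltn_exp2r.
Qed.

(** The tolerance shrinks like 1/(t + 1), so the variance term is of order t^2/n. With t near the
    cube root of n it is O(1/t), and the exponential decay of a^t absorbs the other two terms. *)
Lemma failure_bound_small (R : realType) (a v c delta : R) :
    0 < a < 1 -> 0 <= v -> 0 < c -> 0 < delta ->
  exists n0 : nat, forall n, (n0 < n)%N -> exists t : nat,
    n%:R * a ^+ t +
    (n%:R * v + n%:R ^+ 2 * (t%:R * a ^+ t) ^+ 2) / (n%:R * (c / t.+1%:R)) ^+ 2 < delta.
Proof.
move=> a01 v0 c0 delta0; have [K K0 aK] := succX4_geom_bounded a01.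
case/andP: a01 => a0 a1.
pose C := K + 4 * v / c ^+ 2 + K ^+ 2 / c ^+ 2.
have C0 : 0 < C.
  rewrite addr_gt0 ?divr_gt0 ?exprn_gt0 // ltr_wpDr //.
  by rewrite divr_ge0 ?sqr_ge0 // mulr_ge0.
(* The failure bound will be C/t. Taking n > N^3 forces t >= N > C/delta. *)
pose N := (Num.truncn (C / delta)).+1.
have CN : C / delta < N%:R by exact: truncnS_gt.
exists (N ^ 3)%N => n Nn; have [t /andP[tn nt]] := cube_root_floor n; exists t.
have Nt : (N <= t)%N by rewrite -ltnS -(@ltn_exp2r _ _ 3) // (ltn_trans Nn).
have t0 : (0 < t)%N by apply: leq_trans Nt.
have n0 : (0 < n)%N by apply: leq_trans tn; rewrite expn_gt0 t0.
set A := a ^+ t in aK *; set x : R := t%:R; set y : R := n%:R.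
have x1 : 1 <= x by rewrite ler1n.
have x0 : 0 < x by lra.
have y0 : 0 < y by rewrite ltr0n.
have xy : x ^+ 3 <= y by rewrite -natrX ler_nat.
have yx : y <= (x + 1) ^+ 3 by rewrite natr1 -natrX ler_nat ltnW.
have A0 : 0 < A by rewrite exprn_gt0.
have {aK} AK : (x + 1) ^+ 4 * A <= K by rewrite natr1.
rewrite -natr1 -/x.
have z0 : 0 < x + 1 by lra.
have bound1 : y * A <= K / x.
  rewrite ler_pdivlMr //; apply: le_trans AK.
  rewrite mulrAC ler_pM2r // exprSr ler_pM // ?ltW //; lra.
have bound2 : v * (x + 1) ^+ 2 / (y * c ^+ 2) <= 4 * v / c ^+ 2 / x.
  have -> : 4 * v / c ^+ 2 / x = v * (4 * x ^+ 2) / (x ^+ 3 * c ^+ 2).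
    by field; rewrite !gt_eqF.
  apply: ler_pM; rewrite ?mulr_ge0 ?invr_ge0 ?mulr_ge0 ?exprn_ge0
     ?(ltW y0) ?(ltW z0) ?(ltW c0) //.
    by rewrite ler_wpM2l //; nra.
  by rewrite lef_pV2 ?posrE ?mulr_gt0 ?exprn_gt0 // ler_pM2r ?exprn_gt0.
have bound3 : (x * A * (x + 1)) ^+ 2 / c ^+ 2 <= K ^+ 2 / c ^+ 2 / x.
  rewrite [leRHS]mulrAC ler_pM2r ?invr_gt0 ?exprn_gt0 // ler_pdivlMr //.
  apply: (@le_trans _ _ (((x + 1) ^+ 4 * A) ^+ 2)); last first.
    by rewrite lerXn2r // nnegrE ltW // mulr_gt0 // exprn_gt0.
  have -> : (x * A * (x + 1)) ^+ 2 * x = x ^+ 3 * (x + 1) ^+ 2 * A ^+ 2 by ring.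
  have -> : ((x + 1) ^+ 4 * A) ^+ 2 =
      (x + 1) ^+ 3 * (x + 1) ^+ 2 * (x + 1) ^+ 3 * A ^+ 2 by ring.
  rewrite ler_pM2r ?exprn_gt0 //.
  apply: (@le_trans _ _ ((x + 1) ^+ 3 * (x + 1) ^+ 2)).
    by rewrite ler_pM2r ?exprn_gt0 // lerXn2r // ?nnegrE; lra.
  by rewrite ler_peMr ?mulr_ge0 ?exprn_ge0 ?exprn_ege1 //; lra.
have -> : (y * v + y ^+ 2 * (x * A) ^+ 2) / (y * (c / (x + 1))) ^+ 2 =
    v * (x + 1) ^+ 2 / (y * c ^+ 2) + (x * A * (x + 1)) ^+ 2 / c ^+ 2.
  by field; rewrite !gt_eqF.
apply: (@le_lt_trans _ _ (C / x)).
  by rewrite /C 2!(mulrDl _ _ x^-1); lra.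
rewrite ltr_pdivrMr // mulrC -ltr_pdivrMr //.
by apply: lt_le_trans CN _; rewrite ler_nat.
Qed.

Theorem theorem11 (R : realType) :
  is_estimator (@plug_in R) /\
  PAC_learns_relative (@plug_in R) (@geometric_family R).
Proof.
split; first exact: plug_in_estimator.
move=> p [a [a01 pa]] eps delta eps0 delta0; case/andP: (a01) => a0 a1.
(* The cap 1/2 serves the ratio bound; eps/4 gives a relative error of at most eps/2, hence strictly
   below eps. *)
pose th := Num.min 2^-1 (eps / 4).
have th0 : 0 < th by rewrite lt_min invr_gt0 ltr0n divr_gt0.
have [th2 theps] : th <= 2^-1 /\ th <= eps / 4 by rewrite !ge_min !lexx orbT.
have aa0 : 0 < a * (1 - a) by rewrite mulr_gt0 // subr_gt0.
have v0 : 0 <= a / (1 - a) ^+ 2 by rewrite divr_ge0 ?sqr_ge0 // ltW.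
(* The constant c = th a (1 - a) matches h = th/(t + 1). The threshold is fixed here, before the
   probability space is introduced. *)
have [n0 small] := failure_bound_small a01 v0 (mulr_gt0 th0 aa0) delta0.
exists n0 => d T P X Xp n n0n; have [t fail_lt] := small n n0n.
have n_gt0 : (0 < n)%N by apply: leq_ltn_trans n0n.
have h0 : 0 < th / t.+1%:R by rewrite divr_gt0.
have hth : t.+1%:R * (th / t.+1%:R) <= th by rewrite mulrC divfK ?pnatr_eq0.
have := plug_in_success Xp n_gt0 a01 pa h0 hth th2.
move=> success; apply: lt_le_trans (le_trans success _).
  rewrite lte_fin -addrA -opprD ltrD2l ltrN2.
  by rewrite [th / _ * _]mulrAC.
apply: le_measure; rewrite ?inE.
- exact: (measurable_sample _ (fun s => `|plug_in R s / missing_mass p s - 1| <= 2 * th)).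
- exact: (measurable_sample _ (fun s => `|plug_in R s / missing_mass p s - 1| < eps)).
- by move=> w /= near1; apply: le_lt_trans near1 _; lra.
Qed.
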